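(* For $x:\mathbb{R}_D$ the following propositions are equivalent: (1) $\|\operatorname{locator}(x)\|$, i.e. there exists a locator for $x$; (2) there exists a signed-digit representation of $x$; (3) there exists a Cauchy sequence of rationals of which $x$ is the limit; (4) $\operatorname{isCauchyReal}(x)$.
   Context: Work in Martin-Löf type theory with propositional truncation $\|\cdot\|$, function extensionality and propositional extensionality; ''there exists'' means truncated existence. A Dedekind real is a pair $x=(L,U)$ of proposition-valued predicates on $\mathbb{Q}$, writing $q<x$ for $q\in L$ and $x<r$ for $r\in U$, which is bounded, rounded, transitive and located ($q<r\Rightarrow\|(q<x)+(x<r)\|$). $\mathbb{R}_D$ is the type of Dedekind reals (Cauchy complete). A locator for $x$ is a function $\prod_{q,r:\mathbb{Q}}(q<r)\to(q<x)+(x<r)$ into the untruncated disjoint sum. A signed-digit representation of $x$ is $k:\mathbb{Z}$ and $a:\mathbb{N}\to\{-9,\dots,9\}$ with $x=k+\sum_{i\ge0}a_i10^{-i-1}$. A Cauchy sequence of rationals is a sequence $s:\mathbb{N}\to\mathbb{Q}$ with a modulus $M:\mathbb{Q}_+\to\mathbb{N}$ such that $|s_m-s_n|<\varepsilon$ for $m,n\ge M(\varepsilon)$. $\operatorname{isCauchyReal}(x)$ is the proposition that $x$ lies in the image of the canonical inclusion $\mathbb{R}_C\to\mathbb{R}_D$ of the Cauchy reals into the Dedekind reals. *)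

(* Defs.v *)
From mathcomp Require Import all_boot all_order all_algebra.
From mathcomp Require Import zify ring lra.
From Stdlib Require Import FunctionalExtensionality PropExtensionality.
From Stdlib Require Import ProofIrrelevance.

Set Implicit Arguments.
Unset Strict Implicit.
Unset Printing Implicit Defensive.

Import Order.TTheory GRing.Theory Num.Theory.
Local Open Scope ring_scope.

(* Proposition-valued predicates are [Prop]-valued predicates, and the
   propositional truncation and "there exists" are rendered by [inhabited], [\/] and
   [exists], none of which can be eliminated into data.  All data (locators,
   digit sequences, moduli) are ordinary functions into [Set]. *)

(* [lower x q] is "q < x" and [upper x r] is "x < r". *)
Record RD : Type := MkRD {
  lower : rat -> Prop;
  upper : rat -> Prop;
  RD_bounded : (exists q, lower q) /\ (exists r, upper r);
  RD_rounded :
    (forall q, lower q <-> exists q', q < q' /\ lower q') /\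
    (forall r, upper r <-> exists r', r' < r /\ upper r');
  RD_transitive : forall q r, lower q -> upper r -> q < r;
  RD_located : forall q r, q < r -> lower q \/ upper r
}.

Definition locator (x : RD) : Type :=
  forall q r : rat, q < r -> {lower x q} + {upper x r}.

Definition Qpos : Type := {e : rat | 0 < e}.

Record cauchy_seq : Type := MkCauchySeq {
  cs_seq :> nat -> rat;
  cs_mod : Qpos -> nat;
  cs_cauchy : forall (e : Qpos) (m n : nat),
    (cs_mod e <= m)%N -> (cs_mod e <= n)%N ->
    `|cs_seq m - cs_seq n| < sval e
}.

(* |x - s n| < e, for the rational s n, says s n - e < x < s n + e. *)
Definition is_limit (s : nat -> rat) (x : RD) : Prop :=
  forall e : rat, 0 < e -> exists N : nat, forall n : nat, (N <= n)%N ->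
    lower x (s n - e) /\ upper x (s n + e).

Lemma RD_ext (x y : RD) :
  (forall q, lower x q <-> lower y q) ->
  (forall r, upper x r <-> upper y r) -> x = y.
Proof.
case: x => Lx Ux bx rx tx lx; case: y => Ly Uy by_ ry ty ly /= eL eU.
have {}eL : Lx = Ly.
  by apply: functional_extensionality => q; apply: propositional_extensionality.
have {}eU : Ux = Uy.
  by apply: functional_extensionality => q; apply: propositional_extensionality.
by subst; f_equal; apply: proof_irrelevance.
Qed.

(* The limit of a Cauchy sequence of rationals, as an element of RD. *)
Section Limit.
Variable c : cauchy_seq.

Definition lim_lower (q : rat) : Prop :=
  exists (q' : rat) (N : nat), q < q' /\ forall n, (N <= n)%N -> q' < c n.

Definition lim_upper (r : rat) : Prop :=
  exists (r' : rat) (N : nat), r' < r /\ forall n, (N <= n)%N -> c n < r'.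

Lemma cs_near (e : rat) : 0 < e -> exists N : nat,
  forall n, (N <= n)%N -> c N - e < c n < c N + e.
Proof.
move=> e0; exists (cs_mod c (exist _ e e0)) => n le_n.
have := cs_cauchy (e := exist _ e e0) le_n (leqnn _).
by rewrite /= ltr_distl.
Qed.

Lemma lim_bounded : (exists q, lim_lower q) /\ (exists r, lim_upper r).
Proof.
have [N near_N] := cs_near (e := 1) ltr01.
split; [exists (c N - 2), (c N - 1), N | exists (c N + 2), (c N + 1), N].
- by split; [lra | move=> n /near_N /andP[]].
- by split; [lra | move=> n /near_N /andP[]].
Qed.

Lemma lim_rounded :
  (forall q, lim_lower q <-> exists q', q < q' /\ lim_lower q') /\
  (forall r, lim_upper r <-> exists r', r' < r /\ lim_upper r').
Proof.
split=> q; split.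
- case=> q' [N [lt_q HN]]; exists ((q + q') / 2); split; first by lra.
  by exists q', N; split=> //; lra.
- case=> q1 [lt_q [q' [N [lt_q1 HN]]]]; exists q', N; split=> //; lra.
- case=> q' [N [lt_q HN]]; exists ((q + q') / 2); split; first by lra.
  by exists q', N; split=> //; lra.
- case=> q1 [lt_q [q' [N [lt_q1 HN]]]]; exists q', N; split=> //; lra.
Qed.

Lemma lim_transitive q r : lim_lower q -> lim_upper r -> q < r.
Proof.
case=> q' [N [lt_q HN]] [r' [N' [lt_r HN']]].
have := HN _ (leq_maxl N N'); have := HN' _ (leq_maxr N N'); lra.
Qed.

Lemma lim_located q r : q < r -> lim_lower q \/ lim_upper r.
Proof.
move=> lt_qr; have [|N near_N] := cs_near (e := (r - q) / 4); first by lra.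
have [le_mc|lt_cm] := lerP ((q + r) / 2) (c N).
- left; exists ((q + r) / 2 - (r - q) / 4), N; split; first by lra.
  by move=> n /near_N /andP[]; lra.
- right; exists ((q + r) / 2 + (r - q) / 4), N; split; first by lra.
  by move=> n /near_N /andP[]; lra.
Qed.

Definition RD_lim : RD :=
  MkRD lim_bounded lim_rounded lim_transitive lim_located.

Lemma RD_lim_is_limit : is_limit c RD_lim.
Proof.
move=> e e0; have [|N near_N] := cs_near (e := e / 4); first by lra.
exists N => n /near_N /andP[ln un]; split.
- exists (c N - e / 4), N; split; first by lra.
  by move=> k /near_N /andP[].
- exists (c N + e / 4), N; split; first by lra.
  by move=> k /near_N /andP[].
Qed.

End Limit.

(* Cauchy reals: the set quotient of Cauchy sequences by "the difference tends
   to 0", as the type of equivalence classes. *)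
Definition cauchy_eq (c d : cauchy_seq) : Prop :=
  forall e : rat, 0 < e -> exists N : nat, forall n : nat, (N <= n)%N ->
    `|c n - d n| < e.

Definition is_class (P : cauchy_seq -> Prop) : Prop :=
  exists c : cauchy_seq, forall d : cauchy_seq, P d <-> cauchy_eq c d.

Definition RC : Type := {P : cauchy_seq -> Prop | is_class P}.

Definition RC_class (c : cauchy_seq) : RC :=
  exist is_class (cauchy_eq c) (ex_intro _ c (fun d => iff_refl _)).

Lemma cauchy_eq_refl c : cauchy_eq c c.
Proof. by move=> e e0; exists 0%N => n _; rewrite subrr normr0. Qed.

Lemma cauchy_eq_sym c d : cauchy_eq c d -> cauchy_eq d c.
Proof.
by move=> cd e /cd [N HN]; exists N => n /HN; rewrite distrC.
Qed.

Lemma cauchy_eq_lower c d q : cauchy_eq c d -> lim_lower c q -> lim_lower d q.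
Proof.
move=> cd [q' [N [lt_q HN]]].
have [|N' HN'] := cd ((q' - q) / 2); first by lra.
exists ((q + q') / 2), (maxn N N'); split; first by lra.
move=> n; rewrite geq_max => /andP[/HN ltn /HN'].
by rewrite ltr_distl => /andP[]; lra.
Qed.

Lemma cauchy_eq_upper c d r : cauchy_eq c d -> lim_upper c r -> lim_upper d r.
Proof.
move=> cd [r' [N [lt_r HN]]].
have [|N' HN'] := cd ((r - r') / 2); first by lra.
exists ((r + r') / 2), (maxn N N'); split; first by lra.
move=> n; rewrite geq_max => /andP[/HN ltn /HN'].
by rewrite ltr_distl => /andP[]; lra.
Qed.

(* The canonical inclusion sends the class of c to the limit of c (see
   [RC_incl_class]); no representative is chosen, the cuts of the limits of all
   representatives, which coincide, are joined instead. *)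
Section Inclusion.
Variable u : RC.

Definition incl_lower (q : rat) : Prop := exists c, sval u c /\ lower (RD_lim c) q.
Definition incl_upper (r : rat) : Prop := exists c, sval u c /\ upper (RD_lim c) r.

Lemma incl_repr : exists c, sval u c /\
  (forall q, incl_lower q <-> lower (RD_lim c) q) /\
  (forall r, incl_upper r <-> upper (RD_lim c) r).
Proof.
rewrite /incl_lower /incl_upper; case: u => P [c Pc] /=.
have Pcc : P c by apply/Pc/cauchy_eq_refl.
exists c; split=> //; split=> q; split.
- by case=> d [/Pc /cauchy_eq_sym cd]; apply: cauchy_eq_lower.
- by exists c.
- by case=> d [/Pc /cauchy_eq_sym cd]; apply: cauchy_eq_upper.
- by exists c.
Qed.

Lemma incl_bounded : (exists q, incl_lower q) /\ (exists r, incl_upper r).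
Proof.
have [c [_ [eL eU]]] := incl_repr.
have [[q Lq] [r Ur]] := RD_bounded (RD_lim c).
by split; [exists q; apply/eL | exists r; apply/eU].
Qed.

Lemma incl_rounded :
  (forall q, incl_lower q <-> exists q', q < q' /\ incl_lower q') /\
  (forall r, incl_upper r <-> exists r', r' < r /\ incl_upper r').
Proof.
have [c [_ [eL eU]]] := incl_repr.
have [rL rU] := RD_rounded (RD_lim c).
split=> q; split.
- by move=> /eL /rL [q' [lt_q /eL Lq']]; exists q'.
- by case=> q' [lt_q /eL Lq']; apply/eL/rL; exists q'.
- by move=> /eU /rU [q' [lt_q /eU Lq']]; exists q'.
- by case=> q' [lt_q /eU Lq']; apply/eU/rU; exists q'.
Qed.

Lemma incl_transitive q r : incl_lower q -> incl_upper r -> q < r.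
Proof.
have [c [_ [eL eU]]] := incl_repr.
by move=> /eL Lq /eU; apply: RD_transitive.
Qed.

Lemma incl_located q r : q < r -> incl_lower q \/ incl_upper r.
Proof.
have [c [_ [eL eU]]] := incl_repr.
by move=> /(RD_located (RD_lim c)) [/eL|/eU]; [left | right].
Qed.

Definition RC_incl : RD :=
  MkRD incl_bounded incl_rounded incl_transitive incl_located.

End Inclusion.

Lemma RC_incl_class (c : cauchy_seq) : RC_incl (RC_class c) = RD_lim c.
Proof.
apply: RD_ext => q; split.
- by case=> d [/cauchy_eq_sym cd]; apply: cauchy_eq_lower.
- by exists c; split=> //; apply: cauchy_eq_refl.
- by case=> d [/cauchy_eq_sym cd]; apply: cauchy_eq_upper.
- by exists c; split=> //; apply: cauchy_eq_refl.
Qed.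

Definition isCauchyReal (x : RD) : Prop := exists u : RC, RC_incl u = x.

(* p + x for a rational p. *)
Section Translate.
Variables (p : rat) (x : RD).

Definition tr_lower (q : rat) : Prop := lower x (q - p).
Definition tr_upper (r : rat) : Prop := upper x (r - p).

Lemma tr_bounded : (exists q, tr_lower q) /\ (exists r, tr_upper r).
Proof.
have [[q Lq] [r Ur]] := RD_bounded x.
split; [exists (q + p) | exists (r + p)].
- by rewrite /tr_lower addrK.
- by rewrite /tr_upper addrK.
Qed.

Lemma tr_rounded :
  (forall q, tr_lower q <-> exists q', q < q' /\ tr_lower q') /\
  (forall r, tr_upper r <-> exists r', r' < r /\ tr_upper r').
Proof.
have [rL rU] := RD_rounded x; rewrite /tr_lower /tr_upper.
split=> q; split.
- by move=> /rL [q' [lt_q Lq']]; exists (q' + p); rewrite addrK; split=> //; lra.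
- by case=> q' [lt_q Lq']; apply/rL; exists (q' - p); split=> //; lra.
- by move=> /rU [q' [lt_q Uq']]; exists (q' + p); rewrite addrK; split=> //; lra.
- by case=> q' [lt_q Uq']; apply/rU; exists (q' - p); split=> //; lra.
Qed.

Lemma tr_transitive q r : tr_lower q -> tr_upper r -> q < r.
Proof. by move=> Lq Ur; have := RD_transitive Lq Ur; lra. Qed.

Lemma tr_located q r : q < r -> tr_lower q \/ tr_upper r.
Proof. by move=> lt_qr; apply: RD_located; lra. Qed.

Definition RD_translate : RD :=
  MkRD tr_bounded tr_rounded tr_transitive tr_located.

End Translate.

Definition digit : Type := {d : int | -9 <= d <= 9}.

Definition digit_sum (a : nat -> digit) (n : nat) : rat :=
  \sum_(i < n) (sval (a i))%:~R * 10 ^- i.+1.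

Definition digit_mod (e : Qpos) : nat := Num.bound (sval e)^-1.

Lemma digit_sum_step (a : nat -> digit) (n d : nat) :
  `|digit_sum a (n + d)%N - digit_sum a n| <= 10 ^- n - 10 ^- (n + d)%N.
Proof.
elim: d => [|d]; first by rewrite addn0 !subrr normr0.
rewrite addnS [digit_sum a (n + d).+1]big_ord_recr /= -/(digit_sum a (n + d)%N).
case: (a (n + d)%N) => z /= /andP[zl zu].
have {}zl : (-9 : rat) <= z%:~R by rewrite -(ler_int rat) in zl; lra.
have {}zu : z%:~R <= (9 : rat) by rewrite -(ler_int rat) in zu; lra.
have -> : (10 : rat) ^- (n + d)%N = 10 * 10 ^- (n + d).+1.
  by rewrite exprS invfM mulrA divff ?mul1r.
have t0 : 0 < (10 : rat) ^- (n + d).+1 by rewrite invr_gt0 exprn_gt0.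
move: (10 ^- (n + d).+1) t0 => t t0.
rewrite !ler_distl => /andP[hl hu]; apply/andP; split; nra.
Qed.

Lemma digit_sum_cauchy (a : nat -> digit) (e : Qpos) (m n : nat) :
  (digit_mod e <= m)%N -> (digit_mod e <= n)%N ->
  `|digit_sum a m - digit_sum a n| < sval e.
Proof.
wlog le_nm : m n / (n <= m)%N => [hw hm hn|_].
  case: (leqP n m) => [|/ltnW] le_; first exact: hw.
  by rewrite distrC; apply: hw.
case: e => e e0; rewrite /digit_mod /= => /upper_nthrootP lt_e.
rewrite -(subnKC le_nm); apply: le_lt_trans (digit_sum_step _ _ _) _.
have t0 : 0 < (10 : rat) ^- (n + (m - n))%N by rewrite invr_gt0 exprn_gt0.
apply: (@lt_trans _ _ (10 ^- n)); first by lra.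
rewrite -[ltRHS]invrK ltf_pV2 ?posrE ?invr_gt0 ?exprn_gt0 //.
by apply: lt_le_trans lt_e _; apply: lerXn2r.
Qed.

Definition digit_series (a : nat -> digit) : cauchy_seq :=
  MkCauchySeq (@digit_sum_cauchy a).

(* k + \sum_(i >= 0) a_i * 10^(-i-1) *)
Definition signed_digit_value (k : int) (a : nat -> digit) : RD :=
  RD_translate k%:~R (RD_lim (digit_series a)).

(* Main.v *)
Require Import Defs.
From mathcomp Require Import all_boot all_order all_algebra.
From mathcomp Require Import zify ring lra.

Set Implicit Arguments.
Unset Strict Implicit.
Unset Printing Implicit Defensive.

Import Order.TTheory GRing.Theory Num.Theory.
Local Open Scope ring_scope.

(** The circle of implications rests on uniqueness of limits. A Cauchy sequence
    with modulus yields a locator: for q < r, an approximation of the limit up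
    to (r - q)/4 is compared with the midpoint of q and r. Conversely, a locator
    yields signed digits: if p - 10 t < x < p + 10 t, scanning the pairs
    p + d t < p + (d + 1) t upwards from d = -9 until the locator answers
    x < p + (d + 1) t gives a digit d with p + (d - 1) t < x < p + (d + 1) t, so
    that p + d t approximates x ten times better. *)

Lemma lower_lt (x : RD) (q q' : rat) : q < q' -> lower x q' -> lower x q.
Proof. by move=> lt_q Lq'; apply/(proj1 (RD_rounded x)); exists q'. Qed.

Lemma upper_lt (x : RD) (r r' : rat) : r' < r -> upper x r' -> upper x r.
Proof. by move=> lt_r Ur'; apply/(proj2 (RD_rounded x)); exists r'. Qed.

(** Roundedness leaves a gap [q < q'] below [x]. A late term of [s] within half that gap of both [x]
    and [y] carries [q] below [y]. *)
Lemma is_limit_lower (s : nat -> rat) (x y : RD) (q : rat) :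
  is_limit s x -> is_limit s y -> lower x q -> lower y q.
Proof.
move=> sx sy /(proj1 (RD_rounded x)) [q' [lt_q Lq']].
have e0 : 0 < (q' - q) / 2 by lra.
have [[N sxN] [N' syN']] := (sx _ e0, sy _ e0).
have [_ Ux] := sxN _ (leq_maxl N N'); have [Ly _] := syN' _ (leq_maxr N N').
by apply: lower_lt Ly; have := RD_transitive Lq' Ux; lra.
Qed.

Lemma is_limit_upper (s : nat -> rat) (x y : RD) (r : rat) :
  is_limit s x -> is_limit s y -> upper x r -> upper y r.
Proof.
move=> sx sy /(proj2 (RD_rounded x)) [r' [lt_r Ur']].
have e0 : 0 < (r - r') / 2 by lra.
have [[N sxN] [N' syN']] := (sx _ e0, sy _ e0).
have [Lx _] := sxN _ (leq_maxl N N'); have [_ Uy] := syN' _ (leq_maxr N N').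
by apply: upper_lt Uy; have := RD_transitive Lx Ur'; lra.
Qed.

Lemma is_limit_unique (s : nat -> rat) (x y : RD) :
  is_limit s x -> is_limit s y -> x = y.
Proof.
move=> sx sy; apply: RD_ext => q; split.
- exact: is_limit_lower sx sy.
- exact: is_limit_lower sy sx.
- exact: is_limit_upper sx sy.
- exact: is_limit_upper sy sx.
Qed.

Lemma is_limit_translate (p : rat) (s : nat -> rat) (x : RD) :
  is_limit s x -> is_limit (fun n => p + s n) (RD_translate p x).
Proof.
move=> sx e /sx [N sxN]; exists N => n /sxN [Ln Un].
rewrite /= /tr_lower /tr_upper; split.
- by have -> : p + s n - e - p = s n - e by ring.
- by have -> : p + s n + e - p = s n + e by ring.
Qed.

Lemma translate_cauchy (p : rat) (c : cauchy_seq) (e : Qpos) (m n : nat) :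
  (cs_mod c e <= m)%N -> (cs_mod c e <= n)%N ->
  `|(p + c m) - (p + c n)| < sval e.
Proof.
move=> le_m le_n; have -> : p + c m - (p + c n) = c m - c n by ring.
exact: cs_cauchy.
Qed.

Definition cauchy_translate (p : rat) (c : cauchy_seq) : cauchy_seq :=
  MkCauchySeq (@translate_cauchy p c).

Lemma signed_digit_value_is_limit (k : int) (a : nat -> digit) :
  is_limit (cauchy_translate k%:~R (digit_series a)) (signed_digit_value k a).
Proof. exact/is_limit_translate/RD_lim_is_limit. Qed.

Lemma expVn10_lt (e : rat) : 0 < e ->
  exists N : nat, forall n, (N <= n)%N -> 10 ^- n < e.
Proof.
(* Past this Archimedean bound, 1/e < 2^n <= 10^n. *)
move=> e0; exists (Num.bound e^-1) => n /upper_nthrootP lt_e.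
rewrite -[ltRHS]invrK ltf_pV2 ?posrE ?invr_gt0 ?exprn_gt0 //.
by apply: lt_le_trans lt_e _; apply: lerXn2r.
Qed.

Lemma RD_lim_locator (c : cauchy_seq) : locator (RD_lim c).
Proof.
move=> q r lt_qr; have e0 : 0 < (r - q) / 4 by lra.
(* The index comes from the modulus itself: the existential of [cs_near] could not be eliminated
   into the untruncated sum. *)
pose N := cs_mod c (exist (fun e : rat => is_true (0 < e)) _ e0).
have near_N n : (N <= n)%N -> c N - (r - q) / 4 < c n < c N + (r - q) / 4.
  by move=> le_n; have := cs_cauchy le_n (leqnn N); rewrite /= ltr_distl.
case: (lerP ((q + r) / 2) (c N)) => [le_mc|lt_cm]; [left | right].
- exists ((q + r) / 2 - (r - q) / 4), N; split; first by lra.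
  by move=> n /near_N /andP[]; lra.
- exists ((q + r) / 2 + (r - q) / 4), N; split; first by lra.
  by move=> n /near_N /andP[]; lra.
Qed.

(** A Boolean form, free of the proof of [q < r], can be scanned with [find]. The value [false] when
    [q < r] fails is arbitrary. *)
Lemma locator_bool (x : RD) : locator x -> exists b : rat -> rat -> bool,
  forall q r, q < r -> if b q r then upper x r else lower x q.
Proof.
move=> f; pose b q r := if (q < r) =P true is ReflectT lt_qr
  then ~~ is_left (f q r lt_qr) else false.
exists b => q r lt_qr; rewrite /b.
by case: eqP => // h; case: (f q r h).
Qed.

Lemma RD_int_approx (x : RD) :
  exists k : int, lower x (k%:~R - 1) /\ upper x (k%:~R + 1).
Proof.
have [[q Lq] [r Ur]] := RD_bounded x.
have lt_qr := RD_transitive Lq Ur.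
pose k0 := Num.floor q; have le_k0 : k0%:~R <= q := floor_le q.
have Lk0 : lower x (k0%:~R - 1) by apply: lower_lt Lq; lra.
pose m := Num.bound (r - k0%:~R).
have Um : upper x (k0%:~R + m%:R + 1).
  apply: upper_lt Ur; have : r - k0%:~R < m%:R by apply: archi_boundP; lra.
  by lra.
(* Climb from [k0] by unit steps; [m] bounds the steps left. Truncated locatedness suffices, since
   the goal is a proposition. *)
move: m Um => m Um; elim: m k0 {le_k0} Lk0 Um => [|m IHm] k Lk Um.
  by exists k; split=> //; rewrite addr0 in Um.
have lt_k : k%:~R < k%:~R + 1 :> rat by lra.
have [Lk1|Uk1] := RD_located x lt_k; last by exists k.
apply: (IHm (k + 1)); rewrite intrD; first by rewrite addrK.
by move: Um; rewrite -natr1 [m%:R + 1]addrC addrA.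
Qed.

Section Digits.
Variables (x : RD) (b : rat -> rat -> bool).
Hypothesis bP : forall q r, q < r -> if b q r then upper x r else lower x q.

Definition digit_test (p t : rat) (i : nat) : bool :=
  b (p + (i%:R - 9) * t) (p + (i%:R - 8) * t).

(** Index [i] encodes the digit i - 9. Only the digits -9 to 8 are tested; if all tests fail, [find]
    returns 18, which encodes 9. *)
Definition digit_index (p t : rat) : nat := find (digit_test p t) (iota 0 18).

Lemma digit_index_le (p t : rat) : (digit_index p t <= 18)%N.
Proof. exact: (find_size _ (iota 0 18)). Qed.

Lemma next_digit_subproof (p t : rat) :
  -9 <= (digit_index p t)%:Z - 9 <= 9.
Proof. by have := digit_index_le p t; lia. Qed.

Definition next_digit (p t : rat) : digit :=
  exist _ ((digit_index p t)%:Z - 9) (next_digit_subproof p t).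

Lemma next_digitP (p t : rat) : 0 < t ->
  lower x (p - 10 * t) -> upper x (p + 10 * t) ->
  let p' := p + (sval (next_digit p t))%:~R * t in
  lower x (p' - t) /\ upper x (p' + t).
Proof.
move=> t0 Lp Up; rewrite /= intrB /=.
have testP i := bP (q := p + (i%:R - 9) * t) (r := p + (i%:R - 8) * t).
have {}testP i : if digit_test p t i then upper x (p + (i%:R - 8) * t)
    else lower x (p + (i%:R - 9) * t) by apply: testP; nra.
have le18 := digit_index_le p t; split.
(* The lower bound comes from the last failed test, or from [Lp] if the first test succeeds. *)
- case Ei: (digit_index p t) => [|i].
    by have -> : p + (0%:R - 9%:~R) * t - t = p - 10 * t by ring.
  have lt_i : (i < digit_index p t)%N by rewrite Ei.
  have := testP i; have := before_find 0%N lt_i.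
  rewrite nth_iota ?add0n; last by lia.
  move=> ->; have -> // : p + (i.+1%:R - 9%:~R) * t - t = p + (i%:R - 9) * t.
  by rewrite -natr1; ring.
(* The upper bound comes from the successful test, or from [Up] if there is none. *)
- case: (ltnP (digit_index p t) 18) => [lt18|ge18].
    have := testP (digit_index p t).
    have has_test : has (digit_test p t) (iota 0 18) by rewrite has_find size_iota.
    have := nth_find 0%N has_test; rewrite nth_iota // add0n => ->.
    by set i := _%:R; have -> : p + (i - 9%:~R) * t + t = p + (i - 8) * t by ring.
  have -> : digit_index p t = 18 by apply/eqP; rewrite eqn_leq le18.
  by have -> : p + (18%:R - 9%:~R) * t + t = p + 10 * t by ring.
Qed.

Variable k : int.
Hypothesis kP : lower x (k%:~R - 1) /\ upper x (k%:~R + 1).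

(** The recursion carries the partial sum, on which the choice of the next digit depends; the digits
    are read off afterwards. *)
Fixpoint digit_approx (n : nat) : rat :=
  if n is m.+1 then digit_approx m
    + (sval (next_digit (digit_approx m) (10 ^- m.+1)))%:~R * 10 ^- m.+1
  else k%:~R.

Definition digits (n : nat) : digit := next_digit (digit_approx n) (10 ^- n.+1).

Lemma digit_approxE (n : nat) : digit_approx n = k%:~R + digit_sum digits n.
Proof.
elim: n => [|n IHn]; first by rewrite /digit_sum big_ord0 addr0.
by rewrite /digit_sum big_ord_recr /= addrA -/(digit_sum digits n) -IHn.
Qed.

Lemma digit_approxP (n : nat) :
  lower x (digit_approx n - 10 ^- n) /\ upper x (digit_approx n + 10 ^- n).
Proof.
elim: n => [|n [Ln Un]]; first by rewrite expr0 invr1.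
(* The error at stage [n] is exactly the 10 t that [next_digitP] requires at the next scale. *)
have Et : (10 : rat) ^- n = 10 * 10 ^- n.+1.
  by rewrite exprS invfM mulrA divff ?mul1r.
by apply: next_digitP; rewrite -?Et // invr_gt0 exprn_gt0.
Qed.

Lemma digits_value : x = signed_digit_value k digits.
Proof.
apply: is_limit_unique (signed_digit_value_is_limit k digits).
move=> e /expVn10_lt [N ltN]; exists N => n /ltN lt_n.
have [Ln Un] := digit_approxP n; rewrite /= -digit_approxE; split.
- by apply: lower_lt Ln; lra.
- by apply: upper_lt Un; lra.
Qed.

End Digits.

Theorem theorem3p38 (x : RD) :
  [<-> inhabited (locator x);
       exists (k : int) (a : nat -> digit), x = signed_digit_value k a;
       exists c : cauchy_seq, is_limit c x;
       isCauchyReal x].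
Proof.
tfae.
- case=> /locator_bool [b bP]; have [k kP] := RD_int_approx x.
  by exists k, (digits b k); apply: digits_value.
- case=> k [a ->]; exists (cauchy_translate k%:~R (digit_series a)).
  exact: signed_digit_value_is_limit.
- case=> c cx; exists (RC_class c); rewrite RC_incl_class.
  exact: is_limit_unique (RD_lim_is_limit c) cx.
(* A representative [c] of the class merely exists, which is enough for an inhabited locator
   type. *)
- case=> u <-; have [c [_ [eL eU]]] := incl_repr u.
  by have -> : RC_incl u = RD_lim c; [apply: RD_ext | split; apply: RD_lim_locator].
Qed.
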